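(* Let $n\in\mathbb{N}$, $\beta\in(0,1)$, and let $\{\hat\xi_v\}_{v\in\mathbb{Z}^2}$ be i.i.d. with $\mathbb{P}(\hat\xi_v=j)=(1-\beta)\beta^j$, $j\in\mathbb{Z}_{\ge0}$. For any $\{p^k_{(a,b)}\}_{(a,b,k)\in I_n\cup I_{n+1}}\in\mathscr{I}$, \[\mathbb{P}\big[\hat W^k_{(a,b)}=p^k_{(a,b)}\ \forall(a,b,k)\in I_n\cup I_{n+1}\big]=(1-\beta)^{(n+2)(n+3)/2}\,\beta^{\sum_{(a,b,k)\in I_{n+1}}p^k_{(a,b)}-\sum_{(a,b,k)\in I_n}p^k_{(a,b)}}.\]
   Context: For $u\preceq v$ (coordinatewise), $\hat L^k_{u,v}$ is the maximum of $\sum_{i=1}^k\sum_{z\in\gamma_i}\hat\xi_z$ over (possibly empty) mutually disjoint up-right lattice paths $\gamma_1,\dots,\gamma_k$ contained in $\{z:u\preceq z\preceq v\}$; $\hat L^0=0$, $\hat W^k_{u,v}=\hat L^k_{u,v}-\hat L^{k-1}_{u,v}$, $\hat W^k_v=\hat W^k_{(0,0),v}$. $I_m=\{(a,b,k):a,b\in\mathbb{Z}_{\ge0},a+b=m,k\in\{1,\dots,1+\min(a,b)\}\}$. $\mathscr{I}\subset\mathbb{Z}_{\ge0}^{I_n\cup I_{n+1}}$ is the set of arrays $\{p^k_{(a,b)}\}$ satisfying $p^k_{(a,b)}\le p^k_{(a+1,b)}$, $p^k_{(a,b)}\ge p^{k+1}_{(a+1,b)}$ whenever $(a,b,k),(a+1,b,k)\in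 I_n\cup I_{n+1}$, and $p^k_{(a,b)}\le p^k_{(a,b+1)}$, $p^k_{(a,b)}\ge p^{k+1}_{(a,b+1)}$ whenever $(a,b,k),(a,b+1,k)\in I_n\cup I_{n+1}$. *)

(* Defs.v *)
From HB Require Import structures.
From mathcomp Require Import all_boot all_order all_algebra.
From mathcomp Require Import all_classical all_reals all_analysis.

Set Implicit Arguments.
Unset Strict Implicit.
Unset Printing Implicit Defensive.

Import Order.TTheory GRing.Theory Num.Theory.

Local Open Scope ring_scope.

Definition site := (int * int)%type.

Definition up_step (x y : site) : bool :=
  ((y.1 == x.1 + 1) && (y.2 == x.2)) || ((y.1 == x.1) && (y.2 == x.2 + 1)).

Definition up_right (s : seq site) : bool :=
  if s is x :: t then path up_step x t else true.

(* The box {z : u <= z <= v} (for u <= v coordinatewise), encoded by offsets. *)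
Definition Box (u v : site) : finType :=
  ('I_(absz (v.1 - u.1)).+1 * 'I_(absz (v.2 - u.2)).+1)%type.

Definition pt (u v : site) (x : Box u v) : site :=
  (u.1 + (x.1 : nat)%:Z, u.2 + (x.2 : nat)%:Z).

Definition is_path_set (u v : site) (S : {set Box u v}) : Prop :=
  exists s : seq (Box u v), up_right (map (@pt u v) s) /\ S = [set x in s].

Definition admissible (u v : site) (k : nat) (F : k.-tuple {set Box u v}) : Prop :=
  (forall i : 'I_k, is_path_set (tnth F i)) /\
  (forall i j : 'I_k, i != j -> [disjoint tnth F i & tnth F j]).

(* \hat L^k_{u,v}: maximal total weight of k disjoint up-right paths in the box
   (an up-right path has no repeated vertex, so its weight is the sum over its
   vertex set).  For k = 0 this is 0. *)
Definition Lhat (xi : site -> nat) (u v : site) (k : nat) : nat :=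
  \max_(F : k.-tuple {set Box u v} | `[< admissible F >])
     \sum_(i < k) \sum_(x in tnth F i) xi (pt x).

Definition What (xi : site -> nat) (u v : site) (k : nat) : int :=
  (Lhat xi u v k)%:Z - (Lhat xi u v k.-1)%:Z.

Definition What0 (xi : site -> nat) (v : site) (k : nat) : int :=
  What xi (0, 0) v k.

Definition inI (m a b k : nat) : bool :=
  (a + b == m)%N && (1 <= k <= (minn a b).+1)%N.

Definition inIU (n a b k : nat) : bool := inI n a b k || inI n.+1 a b k.

(* The set \mathscr{I}; an array is a function p k a b, only its values on
   I_n \cup I_{n+1} matter. *)
Definition in_scrI (n : nat) (p : nat -> nat -> nat -> nat) : Prop :=
  forall a b k,
    (inIU n a b k -> inIU n a.+1 b k ->
       (p k a b <= p k a.+1 b)%N /\ (inIU n a.+1 b k.+1 -> (p k.+1 a.+1 b <= p k a b)%N)) /\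
    (inIU n a b k -> inIU n a b.+1 k ->
       (p k a b <= p k a b.+1)%N /\ (inIU n a b.+1 k.+1 -> (p k.+1 a b.+1 <= p k a b)%N)).

Definition sumI (m : nat) (p : nat -> nat -> nat -> nat) : nat :=
  \sum_(0 <= a < m.+1) \sum_(1 <= k < (minn a (m - a)).+2) p k a (m - a).

(* Main.v *)
(** Write L^k(a, b) for the maximal weight of k disjoint paths in the box
    [0, a] x [0, b], and let N = (a+1, b+1), A = (a+1, b), B = (a, b+1), M = (a, b).
    Everything rests on the tropical octahedron relation
<<
  L^(k+1)(N) + L^k(M) = xi(N) + max(L^(k+1)(A) + L^k(B), L^k(A) + L^(k+1)(B)).
>>
    A family of k disjoint paths is extended to k nonintersecting paths
    x_0 < ... < x_(k-1) defined for all times t = (first + second coordinate), the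
    weight being read inside the box only.  For >=, a (k+1)-family in A and a
    k-family in B are replaced by their pointwise minima and maxima.  For <=, a
    (k+1)-family in N and a k-family in M are superposed and recoloured: switching
    the two colours along the alternating component that contains the path leaving
    through the top row sends this row to B and the last column to A.

    Differences of the relation in k give the local RSK rules
<<
  W^1(N) = xi(N) + max(W^1(A), W^1(B)),
  W^(k+1)(N) + W^k(M) = max(W^(k+1)(A), W^(k+1)(B)) + min(W^k(A), W^k(B)),
>>
    which can be run backwards from any interlacing array.  Hence, by induction
    on n, prescribing W on I_n and I_(n+1) amounts to prescribing xi on the
    triangle a + b <= n + 1, whose total weight is the exponent of beta. *)

Require Import Defs.
From HB Require Import structures.
From mathcomp Require Import all_boot all_order all_algebra zify.
From mathcomp Require Import all_classical all_reals all_analysis.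
Import Order.TTheory GRing.Theory Num.Theory.
Local Open Scope classical_set_scope.
Local Open Scope ring_scope.

Set Implicit Arguments.
Unset Strict Implicit.
Unset Printing Implicit Defensive.

(** * Nonintersecting lattice paths *)

(* [f t] is the first coordinate of the point of the path on the antidiagonal [t]. *)
Definition lattice_path (f : nat -> int) : Prop :=
  forall t, f t <= f t.+1 /\ f t.+1 <= f t + 1.

Definition nonintersecting (k : nat) (x : nat -> nat -> int) : Prop :=
  (forall i, (i < k)%N -> lattice_path (x i)) /\
  (forall i t, (i.+1 < k)%N -> x i t < x i.+1 t).

Definition covers (k : nat) (x : nat -> nat -> int) (c d : nat) : bool :=
  has (fun i => x i (c + d)%N == c%:Z) (iota 0 k).

Definition weight (xi : nat -> nat -> nat) (a b k : nat)
    (x : nat -> nat -> int) : nat :=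
  (\sum_(0 <= c < a.+1) \sum_(0 <= d < b.+1) covers k x c d * xi c d)%N.

Lemma coversP k x c d :
  reflect (exists2 i, (i < k)%N & x i (c + d)%N = c%:Z) (covers k x c d).
Proof.
apply: (iffP hasP) => [[i]|[i ik xi]].
  by rewrite mem_iota => ik /eqP; exists i.
by exists i; [rewrite mem_iota | apply/eqP].
Qed.

Lemma nonintersecting_gap k x i j t : nonintersecting k x ->
  (i <= j)%N -> (j < k)%N -> x i t + j%:Z - i%:Z <= x j t.
Proof.
move=> [_ xlt]; elim: j => [|j IHj] ij jk; first by (have -> : i = 0%N by lia); lia.
have [<-|ne] := eqVneq i j.+1; first by lia.
have := xlt j t jk; have := IHj ltac:(lia) ltac:(lia); lia.
Qed.

Lemma lattice_path_mono f s t : lattice_path f -> (s <= t)%N ->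
  f s <= f t /\ f t <= f s + t%:Z - s%:Z.
Proof.
move=> fP; elim: t => [|t IHt] st; first by (have -> : s = 0%N by lia); lia.
have [->|ne] := eqVneq s t.+1; first by lia.
have := fP t; have := IHt ltac:(lia); lia.
Qed.

(** Puts weights in boxes of different sizes over one common range, for comparison site by site. *)
Lemma weight_widen xi a b k x m n : (a < m)%N -> (b < n)%N ->
  weight xi a b k x =
  (\sum_(0 <= c < m) \sum_(0 <= d < n)
     [&& c <= a, d <= b & covers k x c d] * xi c d)%N.
Proof.
move=> am bn; rewrite /weight (big_nat_widen _ _ m) // [LHS]big_mkcond /=.
apply: eq_bigr => c _; rewrite ltnS; case: (leqP c a) => ca /=; last first.
  by rewrite big1.
rewrite (big_nat_widen _ _ n) // [LHS]big_mkcond /=.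
by apply: eq_bigr => d _; rewrite ltnS; case: (leqP d b).
Qed.

(* Pushes the paths into the box [0, a] x [0, b], up to the corner triangle where
   the bounds of row [b - i] and column [a - k + 1 + i] on path [i] conflict. *)
Definition cap (a b k : nat) (x : nat -> nat -> int) (i t : nat) : int :=
  Num.min (Num.max (x i t) (t%:Z - b%:Z + i%:Z)) (a%:Z - k%:Z + 1 + i%:Z).

Lemma nonintersecting_cap a b k x :
  nonintersecting k x -> nonintersecting k (cap a b k x).
Proof.
move=> [xP xlt]; split=> [i ik t|i t ik]; rewrite /cap.
  by have := xP i ik t; lia.
by have := xlt i t ik; lia.
Qed.

(** A path pushed off [(c, d)] is replaced by another: at time [c + d] path [b - d] has lower bound
    [c] and path [k - 1 - (a - c)] has upper bound [c], and the gaps between paths hold the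
    replacement there. *)
Lemma covers_cap a b k x c d : nonintersecting k x -> (c <= a)%N -> (d <= b)%N ->
  covers k x c d -> covers k (cap a b k x) c d.
Proof.
move=> xP ca db /coversP[i ik xic].
have [j [ij jk cle cge xj]] : exists j, [/\ (j <= i)%N, (j < k)%N,
    (x j (c + d)%N <= c%:Z), (c%:Z <= Num.max (x j (c + d)%N) ((c + d)%N%:Z - b%:Z + j%:Z))
    & (c + d)%N%:Z - b%:Z + j%:Z <= c%:Z].
  case: (leP ((c + d)%N%:Z - b%:Z + i%:Z) c%:Z) => h; first by exists i; split; lia.
  exists (b - d)%N; have bdi : (b - d <= i)%N by lia.
  by have := nonintersecting_gap (c + d) xP bdi ik; split; lia.
apply/coversP; case: (leP c%:Z (a%:Z - k%:Z + 1 + j%:Z)) => h.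
  by exists j; rewrite ?/cap //; lia.
have lk : (k - 1 - (a - c) < k)%N by lia.
exists (k - 1 - (a - c))%N => //; rewrite /cap.
have jl : (j <= k - 1 - (a - c))%N by lia.
have := nonintersecting_gap (c + d) xP jl lk; lia.
Qed.

(** Path [c + k - a.+1] has upper bound [c], and past the antidiagonal [a + b - k] its lower bound
    is at least [c], so [cap] fixes it at [c]. *)
Lemma covers_cap_corner a b k x c d : (c <= a)%N -> (d <= b)%N ->
  (a + b < c + d + k)%N -> covers k (cap a b k x) c d.
Proof.
move=> ca db h; apply/coversP; exists (c + k - a.+1)%N; first lia.
rewrite /cap; lia.
Qed.

(** The larger value moves on; [min + 1] counts only at a collision, where it shifts the
    duplicate. *)
Fixpoint carry (x : nat -> nat -> int) (y : nat -> int) (i t : nat) : int :=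
  if i is i'.+1 then
    Num.max (Num.max (x i' t) (carry x y i' t)) (Num.min (x i' t) (carry x y i' t) + 1)
  else y t.

(* Order statistics of the positions of [x 0], ..., [x k.-1] and [y] at time [t],
   pushed to the right by one step after a collision. *)
Definition insert_path (k : nat) x y (i t : nat) : int :=
  if i == k then carry x y k t else Num.min (x i t) (carry x y i t).

Lemma lattice_path_carry k x y i : nonintersecting k x -> lattice_path y ->
  (i <= k)%N -> lattice_path (carry x y i).
Proof.
move=> [xP _] yP; elim: i => [//|i IHi] ik t /=.
have := IHi ltac:(lia) t; have := xP i ik t; lia.
Qed.

Lemma nonintersecting_insert k x y : nonintersecting k x -> lattice_path y ->
  nonintersecting k.+1 (insert_path k x y).
Proof.
move=> xP yP; split=> [i ik t|i t ik]; rewrite /insert_path.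
  have := lattice_path_carry xP yP (ltac:(lia) : (i <= k)%N) t.
  have [->//|ne] := eqVneq i k.
  have := xP.1 i ltac:(lia) t; lia.
have -> : (i == k) = false by lia.
have [/esym e|ne] := eqVneq i.+1 k; first by rewrite e /=; lia.
by have := xP.2 i t ltac:(lia); rewrite /=; lia.
Qed.

Lemma insert_path_carry k x y i t : nonintersecting k x -> (i <= k)%N ->
  exists2 j, (i <= j < k.+1)%N & insert_path k x y j t = carry x y i t.
Proof.
move=> xP ik; have [m mE] : exists m, (m + i = k)%N by exists (k - i)%N; lia.
elim: m i ik mE => [|m IHm] i ik mE.
  have -> : i = k by lia.
  by exists k; rewrite ?leqnn ?ltnSn // /insert_path eqxx.
case: (leP (carry x y i t) (x i t)) => h.
  by exists i; [lia | rewrite /insert_path; (have -> : (i == k) = false by lia); lia].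
have [j jk e] := IHm i.+1 ltac:(lia) ltac:(lia).
by exists j; [lia | rewrite e /=; lia].
Qed.

Lemma insert_path_old k x y i t : nonintersecting k x -> (i < k)%N ->
  exists2 j, (j < k.+1)%N & insert_path k x y j t = x i t.
Proof.
move=> xP ik; case: (leP (x i t) (carry x y i t)) => h.
  by exists i; [lia | rewrite /insert_path; (have -> : (i == k) = false by lia); lia].
have [j jk e] := @insert_path_carry k x y i.+1 t xP ik.
by exists j; [lia | rewrite e /=; lia].
Qed.

(** Inserting the paths one by one loses no visited position, so later constructions may produce
    paths that meet or cross. *)
Lemma nonintersecting_cover n (p : nat -> nat -> int) :
  (forall l, (l < n)%N -> lattice_path (p l)) ->
  exists2 x, nonintersecting n x & forall l t, (l < n)%N ->
    exists2 i, (i < n)%N & x i t = p l t.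
Proof.
elim: n => [|n IHn] pP; first by exists p.
have [x xP xC] := IHn (fun l ln => pP l (ltnW ln)).
exists (insert_path n x (p n)); first exact: nonintersecting_insert (pP n _).
move=> l t; rewrite ltnS leq_eqVlt => /orP[/eqP->|ln].
  by have [j jn e] := @insert_path_carry n x (p n) 0 t xP (leq0n _); exists j.
have [i ik <-] := xC l t ln; exact: insert_path_old.
Qed.

Definition max_weight (xi : nat -> nat -> nat) (a b k m : nat) : Prop :=
  (forall x, nonintersecting k x -> weight xi a b k x <= m)%N /\
  (exists2 x, nonintersecting k x & weight xi a b k x = m).

Lemma leq_sum_box m n (F G : nat -> nat -> nat) :
  (forall c d, c < m -> d < n -> F c d <= G c d)%N ->
  (\sum_(0 <= c < m) \sum_(0 <= d < n) F c d <=
   \sum_(0 <= c < m) \sum_(0 <= d < n) G c d)%N.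
Proof.
move=> FG; rewrite !big_mkord; apply: leq_sum => c _.
by rewrite !big_mkord; apply: leq_sum => d _; apply: FG.
Qed.

(** Makes the lone weight of the corner part of a site-by-site comparison. *)
Lemma sum_box_delta m n (F : nat -> nat -> nat) c0 d0 : (c0 < m)%N -> (d0 < n)%N ->
  F c0 d0 = (\sum_(0 <= c < m) \sum_(0 <= d < n) ((c == c0) && (d == d0)) * F c d)%N.
Proof.
move=> cm dn; rewrite big_mkord (bigD1 (Ordinal cm)) //= [X in (_ + X)%N]big1.
  rewrite addn0 big_mkord (bigD1 (Ordinal dn)) //= [X in (_ + X)%N]big1.
    by rewrite !eqxx mul1n addn0.
  by move=> d /negbTE dd; rewrite -val_eqE /= in dd; rewrite dd andbF.
move=> c /negbTE cc; rewrite -val_eqE /= in cc; rewrite big1 // => d _.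
by rewrite cc.
Qed.

Lemma weight_cap xi a b k x : nonintersecting k x ->
  (weight xi a b k x <= weight xi a b k (cap a b k x))%N.
Proof.
move=> xP; apply: leq_sum_box => c d ca db; rewrite leq_mul2r; apply/orP; right.
by case: (boolP (covers _ x _ _)) => // /(covers_cap xP (ca : (c <= a)%N) (db : (d <= b)%N)) ->.
Qed.

(** * The octahedron relation *)

(** Pointwise minima, together with the unpaired last path [x0 k], form the large family and maxima
    the small one; no position loses multiplicity. Capping beforehand sends all visits to the last
    column and the top row, absent from the small box, to the large family, and leads [x0 k] to the
    corner, absent from both given boxes. *)
Lemma exchange_up_left xi a b k x y : nonintersecting k.+1 x -> nonintersecting k y ->
  exists x' y', [/\ nonintersecting k.+1 x', nonintersecting k y' &
    (weight xi a.+1 b k.+1 x + weight xi a b.+1 k y + xi a.+1 b.+1 <=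
     weight xi a.+1 b.+1 k.+1 x' + weight xi a b k y')%N].
Proof.
move=> xP yP.
pose x0 := cap a.+1 b k.+1 x; pose y0 := cap a b.+1 k y.
have x0P : nonintersecting k.+1 x0 by apply: nonintersecting_cap.
have y0P : nonintersecting k y0 by apply: nonintersecting_cap.
have x0le i t : x0 i t <= a%:Z - k%:Z + 1 + i%:Z by rewrite /x0 /cap; lia.
have x0ge i t : Num.min (t%:Z - b%:Z + i%:Z) (a%:Z - k%:Z + 1 + i%:Z) <= x0 i t.
  by rewrite /x0 /cap; lia.
have y0le i t : y0 i t <= a%:Z - k%:Z + 1 + i%:Z by rewrite /y0 /cap; lia.
exists (fun i t => if i == k then x0 i t else Num.min (x0 i t) (y0 i t)).
exists (fun i t => Num.max (x0 i t) (y0 i t)); split.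
- split=> [i ik t|i t ik].
    have := x0P.1 i ik t; case: eqVneq => [->|ne]; first lia.
    have := y0P.1 i ltac:(lia) t; lia.
  have := x0P.2 i t ik; have -> : (i == k) = false by lia.
  case: eqVneq => [e|ne]; first lia.
  have := y0P.2 i t ltac:(lia); lia.
- split=> [i ik t|i t ik].
    by have := x0P.1 i (ltnW ik) t; have := y0P.1 i ik t; lia.
  by have := x0P.2 i t (ltnW ik); have := y0P.2 i t ik; lia.
apply: leq_trans (_ : weight xi a.+1 b k.+1 x0 + weight xi a b.+1 k y0 + xi a.+1 b.+1 <= _)%N.
  by rewrite leq_add2r leq_add // weight_cap.
rewrite !(@weight_widen _ _ _ _ _ a.+2 b.+2) ?ltnS //.
rewrite (@sum_box_delta a.+2 b.+2 xi a.+1 b.+1) // -!big_split /=.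
rewrite !big_mkord; apply: leq_sum => -[c ca] _ /=; rewrite -!big_split /=.
rewrite !big_mkord; apply: leq_sum => -[d db] _ /=; rewrite -!mulnDl.
rewrite leq_mul2r; apply/orP; right.
set x' := (fun i t => if i == k then _ else _); set y' := (fun i t => Num.max _ _).
have cx1 : covers k.+1 x0 c d -> covers k.+1 x' c d || covers k y' c d.
  move=> /coversP[i ik xi0]; apply/orP.
  have [e|ne] := eqVneq i k; first by left; apply/coversP; exists i; rewrite // /x' e eqxx -e.
  case: (leP (x0 i (c + d)%N) (y0 i (c + d)%N)) => h.
    by left; apply/coversP; exists i; rewrite // /x' (negbTE ne); lia.
  by right; apply/coversP; exists i; [lia | rewrite /y'; lia].
have cy1 : covers k y0 c d -> covers k.+1 x' c d || covers k y' c d.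
  move=> /coversP[i ik yi0]; apply/orP.
  case: (leP (y0 i (c + d)%N) (x0 i (c + d)%N)) => h.
    by left; apply/coversP; exists i; [lia | rewrite /x'; (have -> : (i == k) = false by lia); lia].
  by right; apply/coversP; exists i; [lia | rewrite /y'; lia].
(* If [x0 i] and [y0 j] meet, the new path [x'] at the larger index and [y'] at the smaller one both
   pass through the common position. *)
have cxy : covers k.+1 x0 c d -> covers k y0 c d ->
    covers k.+1 x' c d && covers k y' c d.
  move=> /coversP[i ik xi0] /coversP[j jk yj0].
  apply/andP; split; apply/coversP.
    exists (maxn i j); first lia; rewrite /x'; case: (leqP i j) => ij.
      have := nonintersecting_gap (c + d) x0P ij ltac:(lia).
      by (have -> : (j == k) = false by lia); lia.
    case: eqVneq => [_ //|ne].
    by have := nonintersecting_gap (c + d) y0P (ltnW ij) ltac:(lia); lia.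
  exists (minn i j); first lia; rewrite /y'; case: (leqP i j) => ij.
    by have := nonintersecting_gap (c + d) y0P ij jk; lia.
  by have := nonintersecting_gap (c + d) x0P (ltnW ij) ltac:(lia); lia.
(* The alternative [d = b.+1] is the corner, where the bounds of [cap] force [x0 k] onto [a.+1]. *)
have right_column : c = a.+1 -> covers k.+1 x0 c d || (d == b.+1) -> covers k.+1 x' c d.
  move=> ca1 h; apply/coversP; exists k; rewrite // /x' eqxx.
  case/orP: h => [/coversP[i ik xi0]|/eqP db1]; last first.
    by have := x0ge k (c + d)%N; have := x0le k (c + d)%N; lia.
  have := x0le i (c + d)%N; (have <- : i = k by have := x0le i (c + d)%N; lia); lia.
have top_row : d = b.+1 -> (c <= a)%N -> covers k y0 c d -> covers k.+1 x' c d.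
  move=> db1 ca1 /coversP[i ik yi0]; apply/coversP; exists i; first lia.
  rewrite /x'; have -> : (i == k) = false by lia.
  by have := x0ge i (c + d)%N; have := y0le i (c + d)%N; lia.
move: cx1 cy1 cxy right_column top_row.
case: (covers k.+1 x0 c d); case: (covers k y0 c d); case: (covers k.+1 x' c d);
  case: (covers k y' c d) => /=; lia.
Qed.

(** Reflection in the diagonal turns the position [x] into [t - x] and reverses the order of the
    paths. *)
Lemma nonintersecting_transpose k x : nonintersecting k x ->
  nonintersecting k (fun i t => t%:Z - x (k.-1 - i)%N t).
Proof.
move=> xP; split=> [i ik t|i t ik]; first by have := xP.1 (k.-1 - i)%N ltac:(lia) t; lia.
have := xP.2 (k.-1 - i.+1)%N t ltac:(lia).
by (have -> : (k.-1 - i.+1).+1 = (k.-1 - i)%N by lia); lia.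
Qed.

Lemma weight_transpose xi a b k x :
  weight (fun c d => xi d c) b a k (fun i t => t%:Z - x (k.-1 - i)%N t) =
  weight xi a b k x.
Proof.
rewrite /weight exchange_big_nat /=; apply: eq_bigr => c _; apply: eq_bigr => d _.
congr (nat_of_bool _ * _)%N; apply/coversP/coversP => -[i ik xE].
  by exists (k.-1 - i)%N; [lia | move: xE; rewrite addnC; lia].
exists (k.-1 - i)%N; first lia.
have -> : (k.-1 - (k.-1 - i))%N = i by lia.
by move: xE; rewrite addnC; lia.
Qed.

Lemma max_weight_transpose xi a b k m : max_weight xi a b k m ->
  max_weight (fun c d => xi d c) b a k m.
Proof.
move=> [mge [x xP xm]]; split.
  move=> y yP; rewrite -weight_transpose; apply: mge; exact: nonintersecting_transpose.
exists (fun i t => t%:Z - x (k.-1 - i)%N t); first exact: nonintersecting_transpose.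
by rewrite weight_transpose.
Qed.

(** * Matchings and the recolouring of superposed families *)

Definition matching (m n : nat) (s : nat -> nat -> bool) : Prop :=
  [/\ forall i j, s i j -> (i < m)%N && (j < n)%N,
      forall i j j', s i j -> s i j' -> j = j' &
      forall i i' j, s i j -> s i' j -> i = i'].

Definition compatible (s : nat -> nat -> bool) (F G : nat -> bool) : Prop :=
  forall i j, s i j -> F i = G j.

(* Union of the matchings [s] and [e]: the surgery keeps track of which ends of
   an alternating path of [s] and [e] carry correlated flags. *)
Lemma matching_compose m n s e : matching m n s -> matching m n e ->
  exists2 s', matching m n s' & (forall i j, e i j -> s' i j) /\
    forall F' G', compatible s' F' G' -> exists F G,
      [/\ compatible s F G, compatible e F G,
          forall i, F i = F' i \/ exists j, e i j &
          forall j, G j = G' j \/ exists i, e i j].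
Proof.
move=> sP eP; have [eb ei ej] := eP.
suff H l : (l <= m)%N -> exists2 s', matching m n s' &
   (forall i j, (i < l)%N -> e i j -> s' i j) /\
    forall F' G', compatible s' F' G' -> exists F G,
      [/\ compatible s F G, forall i j, (i < l)%N -> e i j -> F i = G j,
          forall i, F i = F' i \/ (i < l)%N /\ exists j, e i j &
          forall j, G j = G' j \/ exists2 i, (i < l)%N & e i j].
  have [s' s'P [es' H']] := H m (leqnn _); exists s' => //; split.
    by move=> i j eij; apply: es' => //; have /andP[] := eb _ _ eij.
  move=> F' G' /H'[F [G [FG1 FG2 FF GG]]]; exists F, G; split=> //.
  - by move=> i j eij; apply: FG2 => //; have /andP[] := eb _ _ eij.
  - by move=> i; have [|[]] := FF i; [left | right].
  - by move=> j; have [|[i _ eij]] := GG j; [left | right; exists i].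
elim: l => [|l IHl] lm.
  exists s => //; split=> // F G FG; exists F, G; split=> //; by left.
have [s1 s1P [es1 H1]] := IHl (ltnW lm).
have [/hasP[j0 _ elj0]|/hasPn noe] := boolP (has (e l) (iota 0 n)); last first.
  have noe' j : e l j -> False.
    move=> elj; have /andP[_ jn] := eb _ _ elj.
    by have := noe j; rewrite mem_iota elj => /(_ jn).
  exists s1 => //; split.
    move=> i j; rewrite ltnS leq_eqVlt => /orP[/eqP->/noe'//|]; exact: es1.
  move=> F' G' /H1[F [G [FG1 FG2 FF GG]]]; exists F, G; split=> //.
  - move=> i j; rewrite ltnS leq_eqVlt => /orP[/eqP->/noe'//|]; exact: FG2.
  - by move=> i; have [|[/ltnW il ex]] := FF i; [left | right].
  - by move=> j; have [|[i /ltnW il ex]] := GG j; [left | right; exists i].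
have [b1 i1 j1] := s1P.
(* The edge from [l] to [j0] becomes a pair, and the former partner [i] of [j0] is joined to the
   former partner [j] of [l] along [i - j0 - l - j]. *)
pose s2 i j := ((i == l) && (j == j0)) ||
  [&& i != l, j != j0 & s1 i j || s1 i j0 && s1 l j].
have s2l j : s2 l j = (j == j0) by rewrite /s2 eqxx /= orbF.
have s2j i : s2 i j0 = (i == l) by rewrite /s2 eqxx andbT andbF orbF.
exists s2.
  split.
  - move=> i j /orP[/andP[/eqP-> /eqP->]|/and3P[_ _ /orP[/b1//|/andP[/b1/andP[-> _] /b1/andP[_ ->]]]]] //.
    exact: eb.
  - move=> i j j'; have [->|il] := eqVneq i l; first by rewrite !s2l => /eqP-> /eqP->.
    rewrite /s2 (negbTE il) /= => /andP[jj0 /orP[s1ij|/andP[s1i0 s1lj]]] /andP[j'j0 /orP[s1ij'|/andP[s1i0' s1lj']]].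
    + exact: i1 s1ij s1ij'.
    + by move: jj0; rewrite (i1 _ _ _ s1ij s1i0') eqxx.
    + by move: j'j0; rewrite (i1 _ _ _ s1ij' s1i0) eqxx.
    + exact: i1 s1lj s1lj'.
  - move=> i i' j; have [->|jj0] := eqVneq j j0; first by rewrite !s2j => /eqP-> /eqP->.
    rewrite /s2 (negbTE jj0) !andbF /= => /andP[il /orP[s1ij|/andP[s1i0 s1lj]]] /andP[i'l /orP[s1ij'|/andP[s1i0' s1lj']]].
    + exact: j1 s1ij s1ij'.
    + by move: il; rewrite (j1 _ _ _ s1ij s1lj') eqxx.
    + by move: i'l; rewrite (j1 _ _ _ s1ij' s1lj) eqxx.
    + exact: j1 s1i0 s1i0'.
split.
  move=> i j; rewrite ltnS leq_eqVlt => /orP[/eqP-> elj|il eij].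
    by rewrite s2l (ei _ _ _ elj elj0).
  rewrite /s2 (es1 _ _ il eij) /=.
  have -> : i != l by apply: contraTneq il => ->; rewrite ltnn.
  have -> : j != j0 by apply: contraTneq il => jE; rewrite jE in eij; rewrite (ej _ _ _ eij elj0) ltnn.
  by rewrite orbT.
move=> F' G' FG'.
(* The common flag of [l] and [j0] is read off the former partner of [l], else off that of [j0], and
   is [false] if neither has one; when both exist, the pairs of [s2] make the two readings agree. *)
pose b := if has (s1 l) (iota 0 n) then has (fun j => s1 l j && G' j) (iota 0 n)
          else has (fun i => s1 i j0 && F' i) (iota 0 m).
pose F1 i := if i == l then b else F' i.
pose G1 j := if j == j0 then b else G' j.
have mem_n j i : s1 i j -> j \in iota 0 n by move=> /b1/andP[_]; rewrite mem_iota.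
have mem_m j i : s1 i j -> i \in iota 0 m by move=> /b1/andP[+ _]; rewrite mem_iota.
have bG j : s1 l j -> j != j0 -> b = G' j.
  move=> slj jj0; rewrite /b; have -> : has (s1 l) (iota 0 n).
    by apply/hasP; exists j; rewrite ?(mem_n _ _ slj).
  apply/hasP/idP => [[j' _ /andP[slj' Gj']]|Gj]; first by rewrite (i1 _ _ _ slj slj').
  by exists j; rewrite ?(mem_n _ _ slj) ?slj.
have bF i : s1 i j0 -> i != l -> b = F' i.
  move=> si0 il; rewrite /b; case: ifP => [/hasP[j jn slj]|_].
    have jj0 : j != j0 by apply: contra_neq il => jE; rewrite jE in slj; exact: j1 si0 slj.
    have -> : F' i = G' j by apply: FG'; rewrite /s2 il jj0 si0 slj orbT orbT.
    apply/hasP/idP => [[j' _ /andP[slj' Gj']]|Gj]; first by rewrite (i1 _ _ _ slj slj').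
    by exists j; rewrite ?slj.
  apply/hasP/idP => [[i' _ /andP[si' Fi']]|Fi]; first by rewrite (j1 _ _ _ si0 si').
  by exists i; rewrite ?(mem_m _ _ si0) ?si0.
have FG1 : compatible s1 F1 G1.
  move=> i j sij; rewrite /F1 /G1; have [il|il] := eqVneq i l; have [jj0|jj0] := eqVneq j j0 => //.
  - by apply: bG => //; rewrite -il.
  - by apply/esym/bF => //; rewrite -jj0.
  - by apply: FG'; rewrite /s2 il jj0 sij !orbT.
have [F [G [FGs FGe FF GG]]] := H1 _ _ FG1.
exists F, G; split=> //.
- move=> i j; rewrite ltnS leq_eqVlt => /orP[/eqP-> elj|]; last exact: FGe.
  have -> : j = j0 by apply: ei elj elj0.
  have -> : F l = F1 l by case: (FF l) => [//|[]]; rewrite ltnn.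
  have -> : G j0 = G1 j0.
    by case: (GG j0) => [//|[i' il eij]]; rewrite (ej _ _ _ eij elj0) ltnn in il.
  by rewrite /F1 /G1 !eqxx.
- move=> i; have [->|[il ex]] := FF i; last by right; split=> //; exact: ltnW.
  rewrite /F1; case: eqVneq => [->|_]; last by left.
  by right; split=> //; exists j0.
- move=> j; have [->|[i il ex]] := GG j; last by right; exists i => //; exact: ltnW.
  rewrite /G1; case: eqVneq => [->|_]; last by left.
  by right; exists l.
Qed.

Definition coloured m n (F G : nat -> bool) (q r : nat -> nat -> int) t c : Prop :=
  (exists2 i, (i < m)%N && F i & q i t = c) \/ (exists2 j, (j < n)%N && G j & r j t = c).

Definition touch m n (x y : nat -> nat -> int) t i j : bool :=
  [&& (i < m)%N, (j < n)%N & x i t == y j t].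

Lemma nonintersecting_inj k x i j t : nonintersecting k x -> (i < k)%N -> (j < k)%N ->
  x i t = x j t -> i = j.
Proof.
move=> xP ik jk xij; case: (ltngtP i j) => // ij.
  by have := nonintersecting_gap t xP (ltnW ij) jk; lia.
by have := nonintersecting_gap t xP (ltnW ij) ik; lia.
Qed.

Lemma matching_touch m n x y t : nonintersecting m x -> nonintersecting n y ->
  matching m n (touch m n x y t).
Proof.
move=> xP yP; split.
- by move=> i j /and3P[-> ->].
- move=> i j j' /and3P[_ jn /eqP e] /and3P[_ j'n /eqP e'].
  by apply: (nonintersecting_inj yP jn j'n (t := t)); rewrite -e -e'.
- move=> i i' j /and3P[im _ /eqP e] /and3P[i'm _ /eqP e'].
  by apply: (nonintersecting_inj xP im i'm (t := t)); rewrite e e'.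
Qed.

(* A flag exchanges the colour of a line at time [tau]; the matching pairs the
   lines whose flags are linked by an alternating component of the superposition
   up to [tau].  The recoloured tracks [q i] and [r j] are labelled by the line on
   which they end, hence the last clause: a track follows its line backwards as
   long as this line meets no line of the other family. *)
Lemma recolouring m n x y tau : nonintersecting m x -> nonintersecting n y ->
  exists2 s, matching m n s & forall F G, compatible s F G -> exists q r,
    let A := coloured m n (fun i => ~~ F i) G q r in
    let B := coloured m n F (fun j => ~~ G j) q r in
    [/\ forall i t, (i < m)%N -> (t < tau)%N -> q i t <= q i t.+1 /\ q i t.+1 <= q i t + 1,
        forall j t, (j < n)%N -> (t < tau)%N -> r j t <= r j t.+1 /\ r j t.+1 <= r j t + 1,
        forall i, q i tau = x i tau /\ r i tau = y i tau,
        forall t, (t <= tau)%N ->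
        [/\ forall i, (i < m)%N -> A t (x i t) \/ B t (x i t),
            forall j, (j < n)%N -> A t (y j t) \/ B t (y j t) &
            forall i j, touch m n x y t i j -> A t (x i t) /\ B t (x i t)] &
        forall i t, (i < m)%N -> (t <= tau)%N ->
          (forall u j, (t < u <= tau)%N -> ~~ touch m n x y u i j) -> q i t = x i t].
Proof.
move=> xP yP.
(* Where tracks and lines coincide, touching lines carry equal flags, so one of them has colour [A]
   and the other colour [B]. *)
have now t s F G q r : matching m n s -> compatible s F G ->
    (forall i j, touch m n x y t i j -> s i j) ->
    (forall i, q i t = x i t /\ r i t = y i t) ->
    let A := coloured m n (fun i => ~~ F i) G q r in
    let B := coloured m n F (fun j => ~~ G j) q r in
    [/\ forall i, (i < m)%N -> A t (x i t) \/ B t (x i t),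
        forall j, (j < n)%N -> A t (y j t) \/ B t (y j t) &
        forall i j, touch m n x y t i j -> A t (x i t) /\ B t (x i t)].
  move=> sP FG es qr /=; split.
  - move=> i im; case Fi : (F i); [right | left]; left; exists i; rewrite ?Fi ?im //; exact: (qr i).1.
  - move=> j jn; case Gj : (G j); [left | right]; right; exists j; rewrite ?Gj ?jn //; exact: (qr j).2.
  - move=> i j tij; have Fij := FG _ _ (es _ _ tij); case/and3P: tij => im jn /eqP xy.
    case Fi : (F i); rewrite Fi in Fij; split.
    + by right; exists j; rewrite ?jn -?Fij // xy (qr j).2.
    + by left; exists i; rewrite ?im ?Fi // (qr i).1.
    + by left; exists i; rewrite ?im ?Fi // (qr i).1.
    + by right; exists j; rewrite ?jn -?Fij // xy (qr j).2.
elim: tau => [|tau [s sP IH]].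
  exists (touch m n x y 0); first exact: matching_touch.
  move=> F G FG; exists x, y; split=> // t; rewrite leqn0 => /eqP->.
  exact: now (matching_touch 0 xP yP) FG _ _.
have eP := matching_touch tau.+1 xP yP.
have [s' s'P [es' H]] := matching_compose sP eP.
exists s' => // F' G' FG'; have [F [G [FGs FGe FF GG]]] := H _ _ FG'.
have [q [r [qstep rstep qrtau cover fixed]]] := IH _ _ FGs.
set e := touch m n x y tau.+1 in eP es' FGe FF GG.
have [eb ei ej] := eP.
(* Partners at time [tau.+1]; the default value of [find] on an unmatched line is never reached
   below. *)
pose pj i := find (e i) (iota 0 n); pose pi j := find (e^~ j) (iota 0 m).
have pjE i j : e i j -> pj i = j.
  move=> eij; have hs : has (e i) (iota 0 n).
    by apply/hasP; exists j; rewrite // mem_iota; case/andP: (eb _ _ eij).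
  have := nth_find 0%N hs; rewrite nth_iota; last by move: hs; rewrite has_find size_iota.
  by move=> /ei/(_ eij).
have piE i j : e i j -> pi j = i.
  move=> eij; have hs : has (e^~ j) (iota 0 m).
    by apply/hasP; exists i; rewrite // mem_iota; case/andP: (eb _ _ eij).
  have := nth_find 0%N hs; rewrite nth_iota; last by move: hs; rewrite has_find size_iota.
  by move=> /ej/(_ eij).
have flipF i : F i != F' i -> exists2 j, e i j & G j != G' j.
  move=> Fi; have [E|[j eij]] := FF i; first by rewrite E eqxx in Fi.
  by exists j => //; rewrite -(FGe _ _ eij) -(FG' _ _ (es' _ _ eij)).
have flipG j : G j != G' j -> exists2 i, e i j & F i != F' i.
  move=> Gj; have [E|[i eij]] := GG j; first by rewrite E eqxx in Gj.
  by exists i => //; rewrite (FGe _ _ eij) (FG' _ _ (es' _ _ eij)).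
(* A line whose flag changes takes over the past of the line it touches at [tau.+1]; since they
   share this point, the last step is still legal. *)
pose q' i t := if (t <= tau)%N then if F i == F' i then q i t else r (pj i) t else x i t.
pose r' j t := if (t <= tau)%N then if G j == G' j then r j t else q (pi j) t else y j t.
exists q', r'; split.
- move=> i t im; rewrite ltnS /q' => tt; rewrite tt; have [tlt|tge] := ltnP t tau.
    case: (boolP (F i == F' i)) => [_|/flipF[j eij _]]; first exact: qstep.
    by rewrite (pjE _ _ eij); apply: rstep => //; case/andP: (eb _ _ eij).
  have -> : t = tau by lia.
  case: (boolP (F i == F' i)) => [_|/flipF[j eij _]].
    by rewrite (qrtau i).1; exact: xP.1.
  rewrite (pjE _ _ eij) (qrtau j).2; case/and3P: eij => _ jn /eqP->; exact: yP.1.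
- move=> j t jn; rewrite ltnS /r' => tt; rewrite tt; have [tlt|tge] := ltnP t tau.
    case: (boolP (G j == G' j)) => [_|/flipG[i eij _]]; first exact: rstep.
    by rewrite (piE _ _ eij); apply: qstep => //; case/andP: (eb _ _ eij).
  have -> : t = tau by lia.
  case: (boolP (G j == G' j)) => [_|/flipG[i eij _]].
    by rewrite (qrtau j).2; exact: yP.1.
  rewrite (piE _ _ eij) (qrtau i).1; case/and3P: eij => im _ /eqP<-; exact: xP.1.
- by move=> i; rewrite /q' /r' ltnn.
- move=> t; rewrite leq_eqVlt => /orP[/eqP->|].
    by apply: now s'P FG' _ _ => // i; rewrite /q' /r' ltnn.
  rewrite ltnS => tt.
  (* [phi] and [psi] are the identity and the negation in one order or the other, which treats both
     colours at once. *)
  have transfer (phi psi : bool -> bool) c :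
      (forall u, phi (~~ u) = ~~ phi u) -> (forall u, psi u = ~~ phi u) ->
      coloured m n (fun i => phi (F i)) (fun j => psi (G j)) q r t c ->
      coloured m n (fun i => phi (F' i)) (fun j => psi (G' j)) q' r' t c.
    move=> phiN psiE [[i /andP[im Fi] <-]|[j /andP[jn Gj] <-]].
      case: (boolP (F i == F' i)) => [E|Fi'].
        by left; exists i; rewrite ?im -?(eqP E) // /q' tt E.
      have [j eij Gj'] := flipF _ Fi'; right; exists j.
        have -> : (j < n)%N by case/andP: (eb _ _ eij).
        have FiN : F i = ~~ F' i by move: Fi'; case: (F i); case: (F' i).
        by rewrite -(FG' _ _ (es' _ _ eij)) psiE -phiN -FiN.
      by rewrite /r' tt (negbTE Gj') (piE _ _ eij).
    case: (boolP (G j == G' j)) => [E|Gj'].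
      by right; exists j; rewrite ?jn -?(eqP E) // /r' tt E.
    have [i eij Fi'] := flipG _ Gj'; left; exists i.
      have -> : (i < m)%N by case/andP: (eb _ _ eij).
      have GjN : G j = ~~ G' j by move: Gj'; case: (G j); case: (G' j).
      by rewrite (FG' _ _ (es' _ _ eij)) -[G' j]negbK phiN -GjN -psiE.
    by rewrite /q' tt (negbTE Fi') (pjE _ _ eij).
  have AA c := transfer negb id c (fun=> erefl) (fun u => esym (negbK u)).
  have BB c := transfer id negb c (fun=> erefl) (fun=> erefl).
  have [c1 c2 c3] := cover t tt; split.
  + by move=> i /c1[/AA|/BB]; [left | right].
  + by move=> j /c2[/AA|/BB]; [left | right].
  + by move=> i j /c3[/AA ? /BB ?].
- move=> i t im; rewrite leq_eqVlt /q' => /orP[/eqP->|]; first by rewrite ltnn.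
  rewrite ltnS => tt untouched; rewrite tt.
  case: (boolP (F i == F' i)) => [_|/flipF[j eij _]]; last first.
    by case/negP: (untouched tau.+1 j ltac:(lia)).
  apply: fixed => // u j /andP[tu ut]; apply: untouched; rewrite tu; exact: leqW.
Qed.

Definition visits (k : nat) (x : nat -> nat -> int) t c : Prop :=
  exists2 i, (i < k)%N & x i t = c.

(** Recolouring controls its tracks only up to [tau]; holding them still afterwards gives genuine
    lattice paths. *)
Lemma freeze_path f tau : (forall t, (t < tau)%N -> f t <= f t.+1 /\ f t.+1 <= f t + 1) ->
  lattice_path (fun t => f (minn t tau)).
Proof.
move=> fP t; case: (ltnP t tau) => tt.
  have -> : minn t.+1 tau = t.+1 by lia.
  exact: fP.
have -> : minn t.+1 tau = tau by lia.
by lia.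
Qed.

Lemma coloured_families m n (F G : nat -> bool) (q r : nat -> nat -> int) tau kA
    (p : nat -> nat -> int) :
  (forall i t, (i < m)%N -> (t < tau)%N -> q i t <= q i t.+1 /\ q i t.+1 <= q i t + 1) ->
  (forall j t, (j < n)%N -> (t < tau)%N -> r j t <= r j t.+1 /\ r j t.+1 <= r j t + 1) ->
  (forall l, (l < kA)%N -> (exists2 i, (i < m)%N & p l = q i) \/ exists2 j, (j < n)%N & p l = r j) ->
  (forall i, (i < m)%N -> F i -> exists2 l, (l < kA)%N & p l = q i) ->
  (forall j, (j < n)%N -> G j -> exists2 l, (l < kA)%N & p l = r j) ->
  exists2 A, nonintersecting kA A &
    forall t c, (t <= tau)%N -> coloured m n F G q r t c -> visits kA A t c.
Proof.
move=> qP rP pqr qp rp.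
have [|A AP AC] := @nonintersecting_cover kA (fun l t => p l (minn t tau)).
  move=> l lk; apply: freeze_path => t tt.
  by case: (pqr l lk) => [[i im ->]|[j jn ->]]; [apply: qP | apply: rP].
exists A => // t c tt; have tE : minn t tau = t by lia.
move=> [[i /andP[im Fi] <-]|[j /andP[jn Gj] <-]].
  have [l lk <-] := qp i im Fi; have [i' ik E] := AC l t lk.
  by exists i'; rewrite // E tE.
have [l lk <-] := rp j jn Gj; have [i' ik E] := AC l t lk.
by exists i'; rewrite // E tE.
Qed.

(* After [cap], the antidiagonals beyond [tau] are fully covered whatever the
   families are, so only the points up to [tau] matter; there the top row and the last column of
   the large box are visited by [x 0] and [x k] only. *)
Lemma recoloured_families (a b k tau : nat) x y :
  nonintersecting k.+1 x -> nonintersecting k y ->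
  (tau + k = a + b + 1)%N ->
  (forall i t, x i t <= a%:Z - k%:Z + 1 + i%:Z) ->
  (forall i t, y i t <= a%:Z - k%:Z + 1 + i%:Z) ->
  (forall i t, (t <= tau)%N -> t%:Z - b%:Z - 1 + i%:Z <= x i t) ->
  (forall i t, (t <= tau)%N -> t%:Z - b%:Z + i%:Z <= y i t) ->
  exists kA kB A B, [/\ (kA = k.+1 /\ kB = k) \/ (kA = k /\ kB = k.+1),
    nonintersecting kA A, nonintersecting kB B &
    forall t, (t <= tau)%N ->
      [/\ forall i, (i < k.+1)%N -> visits kA A t (x i t) \/ visits kB B t (x i t),
          forall j, (j < k)%N -> visits kA A t (y j t) \/ visits kB B t (y j t),
          forall i j, touch k.+1 k x y t i j -> visits kA A t (x i t) /\ visits kB B t (x i t),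
          x k t = a%:Z + 1 -> visits kA A t (x k t) &
          x 0%N t = t%:Z - b%:Z - 1 -> visits kB B t (x 0%N t)]].
Proof.
move=> xP yP tauE xle yle xge yge.
(* A path moves right by at most one per time step, exactly the rate of the lower bound on path 0,
   so path 0 cannot leave the top row before [tau]. *)
have row_persists t u : (t <= u <= tau)%N -> x 0%N t = t%:Z - b%:Z - 1 -> x 0%N u = u%:Z - b%:Z - 1.
  move=> /andP[tu utau] xt; have := xge 0%N u utau.
  by have := lattice_path_mono (xP.1 0%N isT) tu; lia.
(* If path 0 is off the top row at [tau], it was never on it before, and [x], [y] serve
   unchanged. *)
case: (eqVneq (x 0%N tau) (tau%:Z - b%:Z - 1)) => [row|norow]; last first.
  exists k.+1, k, x, y; split=> //; first by left.
  move=> t tt; split.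
  - by move=> i ik; left; exists i.
  - by move=> j jk; right; exists j.
  - by move=> i j /and3P[ik jk /eqP e]; split; [exists i | exists j].
  - by move=> _; exists k.
  - by move=> xt; case/eqP: norow; apply: row_persists xt; rewrite tt leqnn.
have [s sP H] := recolouring tau xP yP.
have [sb si sj] := sP.
(* Path 0 and its partner under [s], if any, are flagged: this switches the colours along the
   component of path 0. *)
pose F i := i == 0%N.
have FG : compatible s F (s 0%N).
  move=> i j sij; rewrite /F; case: eqVneq => [<-|i0]; first by rewrite sij.
  by apply/esym/negbTE; apply: contra i0 => s0j; rewrite (sj _ _ _ sij s0j).
have [q [r [qP rP _ cover fixed]]] := H _ _ FG.
suff [kA [kB [A [B [kAB AP BP AC BC]]]]] : exists kA kB A B,
    [/\ (kA = k.+1 /\ kB = k) \/ (kA = k /\ kB = k.+1), nonintersecting kA A, nonintersecting kB B,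
    forall t c, (t <= tau)%N -> coloured k.+1 k (fun i => ~~ F i) (s 0%N) q r t c -> visits kA A t c &
    forall t c, (t <= tau)%N -> coloured k.+1 k F (fun j => ~~ s 0%N j) q r t c -> visits kB B t c].
  exists kA, kB, A, B; split=> // t tt; have [c1 c2 c3] := cover t tt; split.
  - by move=> i /c1[/(AC _ _ tt)|/(BC _ _ tt)]; [left | right].
  - by move=> i /c2[/(AC _ _ tt)|/(BC _ _ tt)]; [left | right].
  - by move=> i j /c3[/(AC _ _ tt) ? /(BC _ _ tt)].
  - move=> xk; apply: AC => //; left; exists k.
      rewrite ltnSn /F /=; apply/eqP => k0; move: xk row; rewrite k0 => xk row.
      by have := lattice_path_mono (xP.1 0%N isT) tt; lia.
    (* Path [k] stays on the last column, where no path [y j] with [j < k] ever comes, so its track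
       is its own line. *)
    apply: fixed => // u j /andP[tu utau]; apply/negP => /and3P[_ jk /eqP xy].
    have := yle j u; have := lattice_path_mono (xP.1 k (ltnSn k)) (ltnW tu); lia.
  - move=> x0; apply: BC => //; left; exists 0%N => //.
    apply: fixed => // u j /andP[tu utau]; apply/negP => /and3P[_ jk /eqP xy].
    have := yge j u utau; have := row_persists t u; rewrite (ltnW tu) utau => /(_ isT x0); lia.
(* A partner [j0] changes colour along with path 0, and the sizes [k.+1] and [k] remain; without a
   partner path 0 alone moves over, and the sizes are exchanged. *)
case: (boolP (has (s 0%N) (iota 0 k))) => [/hasP[j0 _ s0]|/hasPn nos].
  have j0k : (j0 < k)%N by case/andP: (sb _ _ s0).
  have [|||A AP AC] := @coloured_families k.+1 k (fun i => ~~ F i) (s 0%N) q r tau k.+1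
    (fun l => if l == 0%N then r j0 else q l) qP rP.
  - by move=> l lk; case: eqVneq => _; [right; exists j0 | left; exists l].
  - by move=> i ik /negbTE; rewrite /F => i0; exists i; rewrite ?i0.
  - by move=> j jk sj0; exists 0%N; rewrite // (si _ _ _ s0 sj0).
  have [|||B BP BC] := @coloured_families k.+1 k F (fun j => ~~ s 0%N j) q r tau k
    (fun l => if l == j0 then q 0%N else r l) qP rP.
  - by move=> l lk; case: eqVneq => _; [left; exists 0%N | right; exists l].
  - by move=> i ik /eqP->; exists j0; rewrite // eqxx.
  - move=> j jk sj0; exists j; rewrite //; case: eqVneq => // E.
    by rewrite E s0 in sj0.
  by exists k.+1, k, A, B; split=> //; left.
have nos' j : s 0%N j -> False.
  by move=> s0j; have := nos j; rewrite s0j mem_iota; case/andP: (sb _ _ s0j) => _ -> /(_ isT).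
have [|||A AP AC] := @coloured_families k.+1 k (fun i => ~~ F i) (s 0%N) q r tau k
  (fun l => q l.+1) qP rP.
- by move=> l lk; left; exists l.+1.
- by case=> // i ik _; exists i.
- by move=> j _ /nos'.
have [|||B BP BC] := @coloured_families k.+1 k F (fun j => ~~ s 0%N j) q r tau k.+1
  (fun l => if l == k then q 0%N else r l) qP rP.
- by move=> l lk; case: eqVneq => ?; [left; exists 0%N | right; exists l => //; lia].
- by move=> i ik /eqP->; exists k; rewrite // eqxx.
- by move=> j jk _; exists j; [exact: leqW | case: eqVneq => // E; lia].
by exists k, k.+1, A, B; split=> //; right.
Qed.

(** Up to time [a + b + 1 - k] the recoloured families account for every visit; later, [cap] fills
    the corner triangles of both boxes. Top-row visits go to [B] and last-column visits to [A],
    whose boxes contain these sites; only the corner has to be paid for separately. *)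
Lemma exchange_down_right xi a b k x y : nonintersecting k.+1 x -> nonintersecting k y ->
  exists kA kB A B, [/\ (kA = k.+1 /\ kB = k) \/ (kA = k /\ kB = k.+1),
    nonintersecting kA A, nonintersecting kB B &
    (weight xi a.+1 b.+1 k.+1 x + weight xi a b k y <=
     weight xi a.+1 b kA A + weight xi a b.+1 kB B + xi a.+1 b.+1)%N].
Proof.
move=> xP yP.
pose x0 := cap a.+1 b.+1 k.+1 x; pose y0 := cap a b k y.
have x0P : nonintersecting k.+1 x0 by apply: nonintersecting_cap.
have y0P : nonintersecting k y0 by apply: nonintersecting_cap.
have x0le i t : x0 i t <= a%:Z - k%:Z + 1 + i%:Z by rewrite /x0 /cap; lia.
have y0le i t : y0 i t <= a%:Z - k%:Z + 1 + i%:Z by rewrite /y0 /cap; lia.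
have x0ge i t : (t + k <= a + b + 1)%N -> t%:Z - b%:Z - 1 + i%:Z <= x0 i t.
  by rewrite /x0 /cap; lia.
have y0ge i t : (t + k <= a + b + 1)%N -> t%:Z - b%:Z + i%:Z <= y0 i t.
  by rewrite /y0 /cap; lia.
have [kA [kB [A [B [kAB AP BP AB]]]]] : exists kA kB A B,
  [/\ (kA = k.+1 /\ kB = k) \/ (kA = k /\ kB = k.+1), nonintersecting kA A, nonintersecting kB B &
    forall t, (t + k <= a + b + 1)%N ->
      [/\ forall i, (i < k.+1)%N -> visits kA A t (x0 i t) \/ visits kB B t (x0 i t),
          forall j, (j < k)%N -> visits kA A t (y0 j t) \/ visits kB B t (y0 j t),
          forall i j, touch k.+1 k x0 y0 t i j -> visits kA A t (x0 i t) /\ visits kB B t (x0 i t),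
          x0 k t = a%:Z + 1 -> visits kA A t (x0 k t) &
          x0 0%N t = t%:Z - b%:Z - 1 -> visits kB B t (x0 0%N t)]].
  have [kab|kab] := leqP k (a + b + 1); last first.
    exists k.+1, k, x0, y0; split=> //; first by left.
    by move=> t; lia.
  have tauE : (a + b + 1 - k + k = a + b + 1)%N by lia.
  have [||kA [kB [A [B [kAB AP BP AB]]]]] := recoloured_families x0P y0P tauE x0le y0le.
  - by move=> i t tt; apply: x0ge; lia.
  - by move=> i t tt; apply: y0ge; lia.
  by exists kA, kB, A, B; split=> // t tt; apply: AB; lia.
exists kA, kB, (cap a.+1 b kA A), (cap a b.+1 kB B); split=> //; try exact: nonintersecting_cap.
apply: leq_trans (_ : weight xi a.+1 b.+1 k.+1 x0 + weight xi a b k y0 <= _)%N.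
  by rewrite leq_add // weight_cap.
rewrite !(@weight_widen _ _ _ _ _ a.+2 b.+2) ?ltnS //.
rewrite (@sum_box_delta a.+2 b.+2 xi a.+1 b.+1) // -!big_split /=.
rewrite !big_mkord; apply: leq_sum => -[c ca] _ /=; rewrite -!big_split /=.
rewrite !big_mkord; apply: leq_sum => -[d db] _ /=; rewrite -!mulnDl.
rewrite leq_mul2r; apply/orP; right.
have coverA : visits kA A (c + d)%N c%:Z -> (d <= b)%N -> covers kA (cap a.+1 b kA A) c d.
  by move=> v db'; apply: covers_cap => //; apply/coversP.
have coverB : visits kB B (c + d)%N c%:Z -> (c <= a)%N -> covers kB (cap a b.+1 kB B) c d.
  by move=> v ca'; apply: covers_cap => //; apply/coversP.
have [late|early] := ltnP (a + b + 1) (c + d + k).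
  have lateA : (d <= b)%N -> covers kA (cap a.+1 b kA A) c d.
    by move=> db'; apply: covers_cap_corner => //; case: kAB => -[-> _]; lia.
  have lateB : (c <= a)%N -> covers kB (cap a b.+1 kB B) c d.
    by move=> ca'; apply: covers_cap_corner => //; case: kAB => -[_ ->]; lia.
  move: lateA lateB.
  case: (covers kA _ c d); case: (covers kB _ c d); case: (covers k.+1 _ c d);
    case: (covers k _ c d) => /=; lia.
have [h1 h2 h3 hcol hrow] := AB (c + d)%N early.
have cx : covers k.+1 x0 c d -> (c <= a)%N -> (d <= b)%N ->
    covers kA (cap a.+1 b kA A) c d || covers kB (cap a b.+1 kB B) c d.
  move=> /coversP[i ik xE] ca' db'; have := h1 i ik; rewrite xE.
  by case=> v; apply/orP; [left; apply: coverA | right; apply: coverB].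
have cy : covers k y0 c d -> (c <= a)%N -> (d <= b)%N ->
    covers kA (cap a.+1 b kA A) c d || covers kB (cap a b.+1 kB B) c d.
  move=> /coversP[i ik xE] ca' db'; have := h2 i ik; rewrite xE.
  by case=> v; apply/orP; [left; apply: coverA | right; apply: coverB].
have cxy : covers k.+1 x0 c d -> covers k y0 c d -> (c <= a)%N -> (d <= b)%N ->
    covers kA (cap a.+1 b kA A) c d && covers kB (cap a b.+1 kB B) c d.
  move=> /coversP[i ik xE] /coversP[j jk yE] ca' db'.
  have := h3 i j; rewrite /touch ik jk xE yE eqxx => /(_ isT)[vA vB].
  by rewrite coverA // coverB.
have ccol : covers k.+1 x0 c d -> c = a.+1 -> (d <= b)%N -> covers kA (cap a.+1 b kA A) c d.
  move=> /coversP[i ik xE] cE db'; apply: coverA => //.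
  have iE : i = k by have := x0le i (c + d)%N; lia.
  by rewrite -xE iE; apply: hcol; rewrite -iE xE; lia.
have crow : covers k.+1 x0 c d -> d = b.+1 -> (c <= a)%N -> covers kB (cap a b.+1 kB B) c d.
  move=> /coversP[i ik xE] dE ca'; apply: coverB => //.
  have iE : i = 0%N by have := x0ge i (c + d)%N early; lia.
  by rewrite -xE iE; apply: hrow; rewrite -iE xE; lia.
move: cx cy cxy ccol crow.
case: (covers kA _ c d); case: (covers kB _ c d); case: (covers k.+1 _ c d);
  case: (covers k _ c d) => /=; lia.
Qed.

Lemma max_weight_octahedron xi a b k mN mM mA mB mA' mB' :
  max_weight xi a.+1 b.+1 k.+1 mN -> max_weight xi a b k mM ->
  max_weight xi a.+1 b k.+1 mA -> max_weight xi a b.+1 k mB ->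
  max_weight xi a.+1 b k mA' -> max_weight xi a b.+1 k.+1 mB' ->
  (mN + mM = xi a.+1 b.+1 + maxn (mA + mB) (mA' + mB'))%N.
Proof.
move=> N M A B A' B'; apply/eqP; rewrite eqn_leq; apply/andP; split.
  case: (N) => _ [x xP <-]; case: (M) => _ [y yP <-].
  have [kA [kB [z [w [kAB zP wP le]]]]] := exchange_down_right xi a b xP yP.
  apply: leq_trans le _; rewrite addnC leq_add2l leq_max; apply/orP.
  case: kAB => -[eA eB]; subst kA kB; [left | right]; apply: leq_add.
  - exact: A.1. - exact: B.1. - exact: A'.1. - exact: B'.1.
rewrite addn_maxr geq_max; apply/andP; split.
  case: (A) => _ [x xP <-]; case: (B) => _ [y yP <-].
  have [x' [y' [x'P y'P le]]] := exchange_up_left xi a b xP yP.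
  rewrite addnC; apply: leq_trans le _; apply: leq_add; [exact: N.1 | exact: M.1].
(* The second term of the maximum is the first one after reflection in the diagonal. *)
have tr := max_weight_transpose.
case: (tr _ _ _ _ _ B') => _ [x xP <-]; case: (tr _ _ _ _ _ A') => _ [y yP <-].
have [x' [y' [x'P y'P le]]] := exchange_up_left (fun c d => xi d c) b a xP yP.
rewrite addnC [X in (X + _)%N]addnC; apply: leq_trans le _.
apply: leq_add; [exact: (tr _ _ _ _ _ N).1 | exact: (tr _ _ _ _ _ M).1].
Qed.

Lemma weight_le_total xi a b k x :
  (weight xi a b k x <= \sum_(0 <= c < a.+1) \sum_(0 <= d < b.+1) xi c d)%N.
Proof. by apply: leq_sum_box => c d _ _; case: (covers _ _ _ _); rewrite ?mul1n ?mul0n. Qed.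

(** The vertical lines [c = i] if [a <= b], and otherwise the horizontal lines [d = b - i], cover
    the whole box. *)
Lemma max_weight_total xi a b k m : (minn a b < k)%N -> max_weight xi a b k m ->
  m = (\sum_(0 <= c < a.+1) \sum_(0 <= d < b.+1) xi c d)%N.
Proof.
move=> abk [mge [x xP xm]]; apply/eqP; rewrite eqn_leq -{1}xm weight_le_total /=.
have full y : nonintersecting k y -> (forall c d, (c <= a)%N -> (d <= b)%N -> covers k y c d) ->
    (\sum_(0 <= c < a.+1) \sum_(0 <= d < b.+1) xi c d <= m)%N.
  move=> yP yC; apply: leq_trans (mge y yP); apply: leq_sum_box => c d ca db.
  by rewrite yC // mul1n.
case: (leqP a b) => ab.
  apply: (full (fun i t => i%:Z)); first by split=> *; [split; lia | lia].
  by move=> c d ca db; apply/coversP; exists c => //; lia.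
apply: (full (fun i t => t%:Z - b%:Z + i%:Z)); first by split=> *; [split; lia | lia].
by move=> c d ca db; apply/coversP; exists (b - d)%N; lia.
Qed.

(** * Comparison with the maximum over path sets *)

Local Notation origin := (0%R : int, 0%R : int).
Local Notation quadrant_box a b := (Box origin (a%:Z, b%:Z)).

Lemma sum_Box a b (f : nat -> nat -> nat) :
  (\sum_(z : quadrant_box a b) f z.1 z.2 =
   \sum_(0 <= c < a.+1) \sum_(0 <= d < b.+1) f c d)%N.
Proof.
rewrite -(pair_bigA _ (fun i j => f (nat_of_ord i) (nat_of_ord j))) /=.
rewrite -(big_mkord xpredT (fun i => \sum_j f i (nat_of_ord j))%N) addn0.
by apply: eq_bigr => c _; rewrite -(big_mkord xpredT (f c)) addn0.
Qed.

Lemma pt_Box a b (z : quadrant_box a b) :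
  pt z = ((z.1 : nat)%:Z, (z.2 : nat)%:Z).
Proof. by rewrite /pt /= !add0r. Qed.

Lemma Box_bound a b (z : quadrant_box a b) : (z.1 <= a)%N /\ (z.2 <= b)%N.
Proof.
have := ltn_ord z.1; have := ltn_ord z.2; by move=> /= ? ?; split; lia.
Qed.

Lemma sorted_filter_iota (p : pred nat) m n :
  (forall s t u, (s <= t <= u)%N -> p s -> p u -> p t) ->
  sorted (fun i j => j == i.+1) [seq i <- iota m n | p i].
Proof.
move=> convex; elim: n m => [//|n IHn] m /=; have := IHn m.+1.
case: ifP => // pm; case: n {IHn} => [//|n] /=; case: ifP => [_|pm1 _] /=.
  by rewrite eqxx.
case E: [seq i <- _ | _] => [//|u s].
have : u \in [seq i <- iota m.+2 n | p i] by rewrite E mem_head.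
rewrite mem_filter mem_iota => /andP[pu /andP[mu _]].
by rewrite (convex m m.+1 u) // ?pm1 // in pm1; rewrite leqnSn ltnW.
Qed.

Lemma path_set_of_lattice_path a b f : lattice_path f ->
  is_path_set [set z : quadrant_box a b | f (z.1 + z.2)%N == (z.1 : nat)%:Z].
Proof.
move=> fP.
pose inb t := [&& 0 <= f t, f t <= a%:Z, f t <= t%:Z & t%:Z <= f t + b%:Z].
pose h t : quadrant_box a b := (inord (absz (f t)), inord (t - absz (f t))).
have h1 t : inb t -> ((h t).1 : nat)%:Z = f t.
  by move=> /and4P[f0 fa ft tb]; rewrite inordK //=; lia.
have h2 t : inb t -> ((h t).2 : nat)%:Z = t%:Z - f t.
  by move=> /and4P[f0 fa ft tb]; rewrite inordK //=; lia.
exists (map h [seq t <- iota 0 (a + b).+1 | inb t]); split; last first.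
  apply/setP => z; rewrite !inE; have [za zb] := Box_bound z.
  apply/eqP/mapP => [fz|[t + ->]].
    have zin : inb (z.1 + z.2)%N by rewrite /inb fz; lia.
    exists (z.1 + z.2)%N; first by rewrite mem_filter zin mem_iota; lia.
    have := h1 _ zin; have := h2 _ zin; rewrite fz; move: (h _) => [u v] /= e2 e1.
    by case: z {fz zin za zb} e1 e2 => z1 z2 /= e1 e2; congr pair; apply: val_inj => /=; lia.
  rewrite mem_filter => /andP[tin _]; have := h1 _ tin; have := h2 _ tin.
  by move=> e2 e1; have -> : ((h t).1 + (h t).2)%N = t by lia.
have -> : forall s, up_right s = sorted up_step s by [].
rewrite !sorted_map; apply: (@sub_in_sorted _ inb (fun i j => j == i.+1)).
- move=> t t' tin t'in /eqP tE; subst t'.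
  change (is_true (up_step (pt (h t)) (pt (h t.+1)))); rewrite /up_step !pt_Box.
  by rewrite (h1 _ tin) (h1 _ t'in) (h2 _ tin) (h2 _ t'in) /=; have := fP t; lia.
- exact: filter_all.
- apply: sorted_filter_iota => s t u /andP[st tu]; rewrite /inb.
  by have := lattice_path_mono fP st; have := lattice_path_mono fP tu; lia.
Qed.

(** The path is followed between its end points and keeps its first coordinate constant outside:
    before [t0] by the truncation in [t - t0], after the end by the default of [nth]. *)
Lemma lattice_path_of_path_set a b (S : {set quadrant_box a b}) : is_path_set S ->
  exists2 f, lattice_path f & forall z, z \in S -> f (z.1 + z.2)%N = (z.1 : nat)%:Z.
Proof.
move=> [s [sP ->]]; case: s sP => [_|x s sP].
  by exists (fun=> 0) => [t|z]; [split | rewrite inE].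
set l := x :: s; pose g j := nth (last x s) l j; pose t0 := (x.1 + x.2)%N.
have gP j : (j < size s)%N -> up_step (pt (g j)) (pt (g j.+1)).
  move=> js; move: sP; rewrite /= path_map => /(pathP (last x s))/(_ j js).
  by rewrite /g /l.
have gconst j : (size s <= j)%N -> g j = last x s.
  move=> sj; rewrite /g /l; case: (ltngtP (size s) j) sj => // [sj _|<- _].
    by rewrite nth_default.
  by rewrite -[size s]/((size l).-1) nth_last.
have gt j : (j <= size s)%N -> ((g j).1 + (g j).2 = t0 + j)%N.
  elim: j => [|j IHj] js; first by rewrite [RHS]addn0.
  have := gP j js; have := IHj (ltnW js); rewrite /up_step !pt_Box /=; lia.
exists (fun t => ((g (t - t0)%N).1 : nat)%:Z).
  move=> t; case: (ltnP t t0) => tt.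
    by have -> : (t.+1 - t0 = t - t0)%N; lia.
  have -> : (t.+1 - t0 = (t - t0).+1)%N by lia.
  have [js|js] := ltnP (t - t0) (size s).
    by have := gP _ js; rewrite /up_step !pt_Box /=; lia.
  by rewrite !gconst //; [lia | exact: leqW].
move=> z; rewrite inE => zs.
have js : (index z l <= size s)%N by rewrite -ltnS -[(size s).+1]/(size l) index_mem.
have gz : g (index z l) = z by rewrite /g nth_index.
by have := gt _ js; rewrite gz => ->; rewrite addKn gz.
Qed.

Lemma weight_le_Lhat xi a b k y : nonintersecting k y ->
  (weight (fun c d => xi (c%:Z, d%:Z)) a b k y <= Lhat xi origin (a%:Z, b%:Z) k)%N.
Proof.
move=> yP.
pose F := [tuple [set z : quadrant_box a b |
                   y i (z.1 + z.2)%N == (z.1 : nat)%:Z]%SET | i < k].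
have FP : `[< admissible F >].
  apply/asboolP; split=> [i|i j ij]; rewrite !tnth_mktuple.
    exact: path_set_of_lattice_path (yP.1 i (ltn_ord i)).
  rewrite -setI_eq0; apply/eqP/setP => z; rewrite !inE; apply/negP => /andP[/eqP yi /eqP yj].
  case/eqP: ij; apply: val_inj => /=.
  by apply: (nonintersecting_inj yP (ltn_ord i) (ltn_ord j) (t := (z.1 + z.2)%N)); rewrite yi yj.
rewrite /Lhat; apply: leq_trans (leq_bigmax_cond _ FP).
rewrite /weight -(sum_Box a b (fun c d => covers k y c d * xi (c%:Z, d%:Z))%N).
rewrite [leqRHS](eq_bigr (fun i : 'I_k => \sum_(z : quadrant_box a b)
    (y i (z.1 + z.2)%N == (z.1 : nat)%:Z) * xi (pt z)))%N; last first.
  move=> i _; rewrite big_mkcond; apply: eq_bigr => z _.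
  by rewrite tnth_mktuple inE; case: eqP; rewrite ?mul1n ?mul0n.
rewrite exchange_big /=; apply: leq_sum => z _; rewrite pt_Box -big_distrl leq_mul2r.
apply/orP; right; case: coversP => //= -[i ik yi].
by rewrite (bigD1 (Ordinal ik)) //= yi eqxx.
Qed.

(** To attain [Lhat], each path of an admissible family is extended to all times; the extensions may
    cross, which [nonintersecting_cover] repairs. Disjointness ensures that no site counts twice. *)
Lemma Lhat_max_weight xi a b k :
  max_weight (fun c d => xi (c%:Z, d%:Z)) a b k (Lhat xi origin (a%:Z, b%:Z) k).
Proof.
split=> [y|]; first exact: weight_le_Lhat.
suff [y yP le] : exists2 y, nonintersecting k y &
    (Lhat xi origin (a%:Z, b%:Z) k <= weight (fun c d => xi (c%:Z, d%:Z)) a b k y)%N.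
  by exists y => //; apply/eqP; rewrite eqn_leq le weight_le_Lhat.
rewrite /Lhat; apply: (big_ind (fun m => exists2 y, nonintersecting k y &
    (m <= weight (fun c d => xi (c%:Z, d%:Z)) a b k y)%N)).
- by exists (fun i t => i%:Z) => //; split=> *; [split; lia | lia].
- move=> m n [x xP mx] [y yP ny]; case: (leqP m n) => _; by [exists y | exists x].
move=> F /asboolP[Fpath Fdisj].
have /choice[p pP] : forall l : nat, exists f, (l < k)%N -> lattice_path f /\
    forall i : 'I_k, i = l :> nat -> forall z, z \in tnth F i -> f (z.1 + z.2)%N = (z.1 : nat)%:Z.
  move=> l; have [lk|] := ltnP l k; last by exists (fun=> 0).
  have [f fP fF] := lattice_path_of_path_set (Fpath (Ordinal lk)).
  exists f => _; split=> // i il; have -> : i = Ordinal lk by apply: val_inj.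
  exact: fF.
have [y yP yC] := nonintersecting_cover (fun l lk => (pP l lk).1).
exists y => //.
rewrite /weight -(sum_Box a b (fun c d => covers k y c d * xi (c%:Z, d%:Z))%N).
rewrite (eq_bigr (fun i : 'I_k => \sum_(z : quadrant_box a b)
    (z \in tnth F i) * xi (pt z)))%N; last first.
  by move=> i _; rewrite big_mkcond; apply: eq_bigr => z _; case: (z \in _); rewrite ?mul1n ?mul0n.
rewrite exchange_big /=; apply: leq_sum => z _; rewrite pt_Box -big_distrl leq_mul2r.
apply/orP; right.
have [i zi|no] := pickP (fun i => z \in tnth F i); last by rewrite big1 // => i _; rewrite no.
rewrite (bigD1 i) //= big1 ?addn0 => [|j ji]; last first.
  by have /pred0P/(_ z) := Fdisj _ _ ji; rewrite /= zi andbT => ->.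
rewrite zi lt0b; apply/coversP.
have [j jk e] := yC i (z.1 + z.2)%N (ltn_ord i); exists j => //.
by rewrite e; apply: (pP i (ltn_ord i)).2 zi.
Qed.

(** * The local rules and their inversion *)

Lemma Lhat0 xi a b : Lhat xi origin (a%:Z, b%:Z) 0 = 0%N.
Proof.
have [_ [x _ <-]] := Lhat_max_weight xi a b 0.
by rewrite /weight big1 // => c _; rewrite big1.
Qed.

Lemma What0E xi a b k : What0 xi (a%:Z, b%:Z) k =
  (Lhat xi origin (a%:Z, b%:Z) k)%:Z - (Lhat xi origin (a%:Z, b%:Z) k.-1)%:Z.
Proof. by []. Qed.

Lemma Lhat_octahedron xi a b k :
  (Lhat xi origin (a.+1%:Z, b.+1%:Z) k.+1 + Lhat xi origin (a%:Z, b%:Z) k =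
   xi (a.+1%:Z, b.+1%:Z) +
   maxn (Lhat xi origin (a.+1%:Z, b%:Z) k.+1 + Lhat xi origin (a%:Z, b.+1%:Z) k)
        (Lhat xi origin (a.+1%:Z, b%:Z) k + Lhat xi origin (a%:Z, b.+1%:Z) k.+1))%N.
Proof.
have H := Lhat_max_weight xi.
exact: max_weight_octahedron (H _ _ _) (H _ _ _) (H _ _ _) (H _ _ _) (H _ _ _) (H _ _ _).
Qed.

Lemma Lhat_total xi a b k : (minn a b < k)%N -> Lhat xi origin (a%:Z, b%:Z) k =
  (\sum_(0 <= c < a.+1) \sum_(0 <= d < b.+1) xi (c%:Z, d%:Z))%N.
Proof. by move=> abk; apply: max_weight_total abk (Lhat_max_weight _ _ _ _). Qed.

(** Subtract the octahedron relations for [k] and [k.-1]: the corner weight cancels, the first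
    maximum exceeds [L^k(A) + L^k(B)] by the [max] term, and the second falls short of it by the
    [min] term. *)
Lemma What0_local xi a b k : (0 < k)%N ->
  What0 xi (a.+1%:Z, b.+1%:Z) k.+1 + What0 xi (a%:Z, b%:Z) k =
  Num.max (What0 xi (a.+1%:Z, b%:Z) k.+1) (What0 xi (a%:Z, b.+1%:Z) k.+1) +
  Num.min (What0 xi (a.+1%:Z, b%:Z) k) (What0 xi (a%:Z, b.+1%:Z) k).
Proof.
case: k => // k _; have := Lhat_octahedron xi a b k; have := Lhat_octahedron xi a b k.+1.
by rewrite !What0E /=; lia.
Qed.

Lemma What0_1 xi a b : What0 xi (a%:Z, b%:Z) 1 = (xi (a%:Z, b%:Z))%:Z +
  Num.max (if a is a'.+1 then What0 xi (a'%:Z, b%:Z) 1 else 0)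
          (if b is b'.+1 then What0 xi (a%:Z, b'%:Z) 1 else 0).
Proof.
case: a b => [|a] [|b]; rewrite !What0E /= !Lhat0.
- by rewrite Lhat_total // !big_nat1; lia.
- rewrite !Lhat_total ?min0n // !big_nat1 [in LHS]big_nat_recr //=; lia.
- by rewrite !Lhat_total ?minn0 // [in LHS]big_nat_recr //= big_nat1 !subr0 max_l ?le0z_nat // PoszD addrC.
- have := Lhat_octahedron xi a b 0; rewrite !Lhat0. lia.
Qed.

Lemma What0_out xi a b k : ((minn a b).+1 < k)%N -> What0 xi (a%:Z, b%:Z) k = 0.
Proof. by move=> abk; rewrite What0E !Lhat_total; lia. Qed.

Lemma What0_sum xi a b : \sum_(1 <= k < (minn a b).+2) What0 xi (a%:Z, b%:Z) k =
  (\sum_(0 <= c < a.+1) \sum_(0 <= d < b.+1) xi (c%:Z, d%:Z))%N%:Z.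
Proof.
rewrite -(@Lhat_total xi a b (minn a b).+1) // big_add1 /=.
rewrite (telescope_sumr (fun k => (Lhat xi origin (a%:Z, b%:Z) k)%:Z)) //.
by rewrite Lhat0 subr0.
Qed.

(** Zero padding beyond [k = 1 + min(a, b)] replaces the index conditions of [in_scrI], so the
    inequalities hold for all positive [k]. *)
Definition interlacing (m : nat) (q : nat -> nat -> nat -> nat) : Prop :=
  (forall a b k, (a + b)%N = m -> (0 < k)%N ->
    [/\ q k a b <= q k a.+1 b, q k.+1 a.+1 b <= q k a b,
        q k a b <= q k a b.+1 & q k.+1 a b.+1 <= q k a b]%N) /\
  (forall a b k, (m <= a + b <= m.+1)%N -> ((minn a b).+1 < k)%N -> q k a b = 0%N).

(* The truncated subtractions of [jump] and [toggle] are exact on interlacing arrays. *)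
Definition jump (q : nat -> nat -> nat -> nat) (a b : nat) : nat :=
  (q 1 a b - maxn (if a is a'.+1 then q 1 a' b else 0) (if b is b'.+1 then q 1 a b' else 0))%N.

Definition toggle (q : nat -> nat -> nat -> nat) (k a b : nat) : nat :=
  (minn (q k a.+1 b) (q k a b.+1) + maxn (q k.+1 a.+1 b) (q k.+1 a b.+1) - q k.+1 a.+1 b.+1)%N.

(** Interlacing confines [q k.+1 a.+1 b.+1] to the interval between the [max] and the [min] in
    [toggle]; the toggled value is its reflection in this interval and so stays there. *)
Lemma interlacing_toggle n q : interlacing n.+1 q ->
  interlacing n (fun k a b => if (a + b == n)%N then toggle q k a b else q k a b).
Proof.
move=> [qi q0]; split=> [a b k ab k0|a b k ab kab].
  rewrite ab eqxx.
  have -> : (a.+1 + b == n)%N = false by lia.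
  have -> : (a + b.+1 == n)%N = false by lia.
  have := qi a.+1 b k ltac:(lia) k0; have := qi a b.+1 k ltac:(lia) k0.
  have := qi a.+1 b k.+1 ltac:(lia) isT; have := qi a b.+1 k.+1 ltac:(lia) isT.
  by rewrite /toggle => -[? ? ? ?] [? ? ? ?] [? ? ? ?] [? ? ? ?]; split; lia.
have [abn|abn] := eqVneq (a + b)%N n; last by apply: q0; lia.
have := qi a.+1 b k.+1 ltac:(lia) isT; have := qi a b.+1 k.+1 ltac:(lia) isT.
rewrite /toggle => -[? ? ? ?] [? ? ? ?].
case: (leqP a b) => leab.
  by have := q0 a b.+1 k ltac:(lia) ltac:(lia); lia.
by have := q0 a.+1 b k ltac:(lia) ltac:(lia); lia.
Qed.

(** In the step to [n.+1], the local rule solved for its lowest corner gives level [n] as the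
    toggled array; this determines [xi] up to the antidiagonal [n.+1], and [jump] gives the next
    one. The equivalence lets an event about [What0] be rewritten as one about [xi]. *)
Lemma What0_bijection n q : interlacing n q -> exists j : nat -> nat -> nat, forall xi : site -> nat,
  (forall a b k, (n <= a + b <= n.+1)%N -> (0 < k)%N -> What0 xi (a%:Z, b%:Z) k = (q k a b)%:Z) <->
  (forall c d, (c + d <= n.+1)%N -> xi (c%:Z, d%:Z) = j c d).
Proof.
elim: n q => [|n IHn] q qP; have [qi q0] := qP.
  exists (jump q) => xi; split=> [W c d cd|xiE a b k ab k0].
    have := What0_1 xi c d; rewrite W // /jump.
    by case: c cd => [|c] cd; case: d cd => [|d] cd; rewrite ?W //; lia.
  have [k1|k1] := ltnP 1 k; first by rewrite What0_out ?q0 //; lia.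
  have -> : k = 1%N by lia.
  have q00 := qi 0%N 0%N 1%N erefl isT.
  have W0 : What0 xi (0%:Z, 0%:Z) 1 = (q 1 0 0)%N.
    by rewrite What0_1 xiE // /jump; lia.
  case: a b ab => [|[|a]] [|[|b]] ab //; try lia.
  - by rewrite What0_1 xiE // /jump W0; case: q00; lia.
  - by rewrite What0_1 xiE // /jump W0; case: q00; lia.
have [j jP] := IHn _ (interlacing_toggle qP).
exists (fun c d => if (c + d <= n.+1)%N then j c d else jump q c d) => xi; split.
  move=> W c d cd; case: (leqP (c + d)%N n.+1) => cd'.
    apply: ((jP xi).1 _ c d cd') => a b k ab k0; case: eqVneq => abn; last by apply: W; lia.
    have := What0_local xi a b k0; rewrite (W a.+1 b.+1) ?(W a.+1 b) ?(W a b.+1) //; try lia.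
    have := qi a.+1 b k ltac:(lia) k0; have := qi a b.+1 k ltac:(lia) k0.
    by rewrite /toggle => -[? ? ? ?] [? ? ? ?]; lia.
  have := What0_1 xi c d; rewrite W; try lia; rewrite /jump.
  case: c cd cd' => [|c] cd cd'; case: d cd cd' => [|d] cd cd'; rewrite /= ?W //; lia.
move=> xiE.
have W : forall a b k, (n <= a + b <= n.+1)%N -> (0 < k)%N -> What0 xi (a%:Z, b%:Z) k =
    (if (a + b == n)%N then toggle q k a b else q k a b)%:Z.
  by apply: (jP xi).2 => c d cd; rewrite xiE ?cd //; exact: leqW.
have W1 a b k : (a + b)%N = n.+1 -> (0 < k)%N -> What0 xi (a%:Z, b%:Z) k = (q k a b)%:Z.
  by move=> ab k0; rewrite W //; [case: eqVneq => //; lia | lia].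
move=> a b k ab k0.
have [abn|abn] := eqVneq (a + b)%N n.+1; first exact: W1.
(* On the new antidiagonal, [k = 1] follows from the rule for [W^1] and larger [k] from the local
   rule, the two levels below being known. *)
case: k k0 => // -[|k] _.
  rewrite What0_1 xiE; last lia.
  have -> : (a + b <= n.+1)%N = false by lia.
  rewrite /jump; case: a ab abn => [|a] ab abn; case: b ab abn => [|b] ab abn.
  - lia.
  - by have := qi 0%N b 1%N ltac:(lia) isT; rewrite W1; try lia; case; lia.
  - by have := qi a 0%N 1%N ltac:(lia) isT; rewrite W1; try lia; case; lia.
  - have := qi a.+1 b 1%N ltac:(lia) isT; have := qi a b.+1 1%N ltac:(lia) isT.
    by rewrite !W1; try lia; case=> ? ? ? ? [? ? ? ?]; lia.
have [ab0|ab0] := leqP (minn a b) 0%N; first by rewrite What0_out ?q0 //; lia.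
case: a b ab abn ab0 => [|a] [|b] ab abn ab0; try lia.
have := @What0_local xi a b k.+1 isT; rewrite [What0 xi (a%:Z, b%:Z) _]W ?(W1 a.+1 b) ?(W1 a b.+1) //; try lia.
have -> : (a + b == n)%N by lia.
have := qi a.+1 b k.+1 ltac:(lia) isT; have := qi a b.+1 k.+1 ltac:(lia) isT.
by rewrite /toggle => -[? ? ? ?] [? ? ? ?]; lia.
Qed.

(** * Sums over triangles and the probability *)

Lemma sum_triangle (m : nat) : (\sum_(0 <= c < m) (m - c) * 2 = m * m.+1)%N.
Proof.
elim: m => [|m IHm]; first by rewrite big_nil.
rewrite big_nat_recl // (eq_bigr (fun c => (m - c) * 2)%N) // IHm; lia.
Qed.

(** For each [a], the box of level [m.+1] exceeds that of level [m] by its top row [d = m.+1 - a],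
    [c <= a]; with the segment left over for [a = m.+1], these rows tile the triangle
    [c + d <= m.+1]. *)
Lemma sum_antidiagonal_boxes (f : nat -> nat -> nat) m :
  (\sum_(0 <= a < m.+2) \sum_(0 <= c < a.+1) \sum_(0 <= d < (m.+1 - a).+1) f c d =
   \sum_(0 <= a < m.+1) \sum_(0 <= c < a.+1) \sum_(0 <= d < (m - a).+1) f c d +
   \sum_(0 <= c < m.+2) \sum_(0 <= d < m.+2 - c) f c d)%N.
Proof.
have -> : (\sum_(0 <= c < m.+2) \sum_(0 <= d < m.+2 - c) f c d =
           \sum_(0 <= a < m.+2) \sum_(0 <= c < a.+1) f c (m.+1 - a))%N.
  transitivity (\sum_(0 <= c < m.+2) \sum_(0 <= a < m.+2 | c < a.+1) f c (m.+1 - a))%N.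
    apply: eq_big_nat => c /andP[_ cm]; rewrite (big_nat_widen _ _ m.+2); last lia.
    rewrite big_nat_rev add0n; apply: congr_big_nat => // a; lia.
  rewrite (exchange_big_dep_nat xpredT) //=; apply: eq_big_nat => a /andP[_ am].
  by rewrite [RHS](big_nat_widen _ _ m.+2).
rewrite big_nat_recr //= [X in (_ = _ + X)%N]big_nat_recr //= addnA; congr (_ + _)%N.
  rewrite -big_split; apply: eq_big_nat => a /andP[_ am] /=.
  rewrite -big_split; apply: eq_bigr => c _ /=.
  have -> : (m.+1 - a = (m - a).+1)%N by lia.
  by rewrite big_nat_recr.
by rewrite subnn; apply: eq_bigr => c _; rewrite big_nat1.
Qed.

Definition triangle (m : nat) : seq site :=
  [seq (c%:Z, d%:Z) | c <- iota 0 m, d <- iota 0 (m - c)].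

Lemma mem_triangle m v : v \in triangle m ->
  exists c d, (c + d < m)%N /\ v = (c%:Z, d%:Z).
Proof.
by move=> /allpairsPdep[c [d [+ + ->]]]; rewrite !mem_iota => cm dm; exists c, d; split => //; lia.
Qed.

Lemma triangle_mem m c d : (c + d < m)%N -> (c%:Z, d%:Z) \in triangle m.
Proof.
by move=> cd; apply/allpairsPdep; exists c, d; rewrite !mem_iota; split => //; lia.
Qed.

Lemma triangle_uniq m : uniq (triangle m).
Proof.
apply: allpairs_uniq_dep => [|c _|]; try exact: iota_uniq.
by move=> [c d] [c' d'] _ _ /= [-> ->].
Qed.

Lemma sum_triangle_sites m (f : site -> nat) :
  (\sum_(v <- triangle m) f v = \sum_(0 <= c < m) \sum_(0 <= d < m - c) f (c%:Z, d%:Z))%N.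
Proof. by rewrite big_allpairs_dep /index_iota subn0; apply: eq_bigr => c _; rewrite subn0. Qed.

Lemma size_triangle m : size (triangle m) = ((m * m.+1) %/ 2)%N.
Proof.
have -> : size (triangle m) = (\sum_(v <- triangle m) 1)%N by rewrite sum1_size.
rewrite sum_triangle_sites -sum_triangle -big_distrl mulnK //=.
by apply: eq_bigr => c _; rewrite sum_nat_const_nat muln1 subn0.
Qed.

Definition extend (p : nat -> nat -> nat -> nat) (k a b : nat) : nat :=
  if (k <= (minn a b).+1)%N then p k a b else 0%N.

Lemma interlacing_extend n p : in_scrI n p -> interlacing n (extend p).
Proof.
move=> hp; split=> [a b k ab k0|a b k _ kab]; last first.
  by rewrite /extend leqNgt kab.
have [] := hp a b k; rewrite /inIU /inI => hr hu.
rewrite /extend; case: (leqP k (minn a b).+1) => kab; last first.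
  have -> : (k.+1 <= (minn a.+1 b).+1)%N = false by lia.
  by have -> : (k.+1 <= (minn a b.+1).+1)%N = false by lia.
have [r1 r2] := hr ltac:(lia) ltac:(lia); have [u1 u2] := hu ltac:(lia) ltac:(lia).
have -> : (k <= (minn a.+1 b).+1)%N by lia.
have -> : (k <= (minn a b.+1).+1)%N by lia.
split=> //; [case: leqP => // h; apply: r2; lia | case: leqP => // h; apply: u2; lia].
Qed.

(** For fixed [(a, b)] the sum over [k] telescopes to the total weight of the box. *)
Lemma sumI_boxes m p xi : (forall a b k, (a + b)%N = m -> (0 < k)%N ->
    What0 xi (a%:Z, b%:Z) k = (extend p k a b)%:Z) ->
  sumI m p = (\sum_(0 <= a < m.+1) \sum_(0 <= c < a.+1) \sum_(0 <= d < (m - a).+1)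
                xi (c%:Z, d%:Z))%N.
Proof.
move=> W; apply: eq_big_nat => a /andP[_ am].
apply/eqP; rewrite -eqz_nat -What0_sum (big_morph Posz PoszD erefl); apply/eqP.
apply: eq_big_nat => k /andP[k0 kab]; rewrite W //; last lia.
by rewrite /extend -ltnS kab.
Qed.

Theorem theoremA2 (d : measure_display) (T : measurableType d) (R : realType)
  (P : probability T R) (X : site -> T -> nat) (beta : R)
  (hbeta0 : 0 < beta) (hbeta1 : beta < 1)
  (hXmeas : forall (v : site) (j : nat), measurable [set w | X v w = j])
  (hiid : forall (S : seq site) (j : site -> nat), uniq S ->
     P [set w | forall v, v \in S -> X v w = j v] =
     ((\prod_(v <- S) ((1 - beta) * beta ^+ j v))%:E)%E)
  (n : nat) (p : nat -> nat -> nat -> nat) (hp : in_scrI n p) :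
  P [set w | forall a b k : nat, inIU n a b k ->
               What0 (fun z => X z w) ((a%:Z, b%:Z)) k = (p k a b)%:Z] =
  (((1 - beta) ^+ (((n + 2) * (n + 3)) %/ 2)%N *
     beta ^ ((sumI n.+1 p)%:Z - (sumI n p)%:Z))%:E)%E.
Proof.
have [j jP] := What0_bijection (interlacing_extend hp).
(* A fixed environment realising the array; [absz] merely extends [j] to all sites. *)
pose jv (v : site) := j (absz v.1) (absz v.2).
have Wj := (jP jv).2 (fun c d _ => erefl).
have -> : [set w | forall a b k : nat, inIU n a b k ->
      What0 (fun z => X z w) (a%:Z, b%:Z) k = (p k a b)%:Z] =
    [set w | forall v, v \in triangle n.+2 -> X v w = jv v].
  apply/seteqP; split=> w /= Hw.
    have Wq a b k : (n <= a + b <= n.+1)%N -> (0 < k)%N ->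
        What0 (fun z => X z w) (a%:Z, b%:Z) k = (extend p k a b)%:Z.
      move=> ab k0; rewrite /extend; case: leqP => kab; last exact: What0_out.
      by apply: Hw; rewrite /inIU /inI; lia.
    by move=> _ /mem_triangle[c [e [ce ->]]]; apply: (jP (fun z => X z w)).1.
  move=> a b k; rewrite /inIU /inI => abk.
  have -> : p k a b = extend p k a b by rewrite /extend; case: leqP => //; lia.
  apply: (jP (fun z => X z w)).2; try lia.
  by move=> c e ce; apply: Hw; apply: triangle_mem.
rewrite hiid ?triangle_uniq //; congr (_%:E).
rewrite big_split /= big_const_seq count_predT -Monoid.iteropE -[LHS]/((1 - beta) ^+ _ * _).
rewrite -(big_morph (fun m => beta ^+ m) (exprD beta) (expr0 beta)).
rewrite size_triangle sum_triangle_sites; congr (_ ^+ _ * _).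
  by congr (_ %/ _)%N; lia.
(* The exponent is computed in the environment [jv], where both level sums are sums of box
   totals. *)
rewrite (@sumI_boxes n.+1 p jv) ?(@sumI_boxes n p jv); try by move=> a b k ab k0; apply: Wj; lia.
by rewrite sum_antidiagonal_boxes PoszD addrAC subrr add0r.
Qed.
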